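(* $$\sum_{k=0}^{\infty}\frac{\binom{2k}{k}\binom{3k}{k}}{54^k}\,(3H_{3k}-H_k)=\frac{(3\log 2)\,\Gamma(\frac{1}{3})^3}{4\pi^2\sqrt[3]{2}}.$$
   Context: For a nonnegative integer $n$, $H_n=\sum_{j=1}^{n}\frac{1}{j}$ denotes the classical harmonic number, with $H_0=0$. $\Gamma$ is the gamma function and $\log$ is the natural logarithm. *)

(* Defs.v *)
From HB Require Import structures.
From mathcomp Require Import all_boot all_order all_algebra.
From mathcomp Require Import all_classical all_reals all_analysis.

Set Implicit Arguments.
Unset Strict Implicit.
Unset Printing Implicit Defensive.

Import Order.TTheory GRing.Theory Num.Theory.
Import numFieldNormedType.Exports.

Local Open Scope classical_set_scope.
Local Open Scope ring_scope.

Definition harmonic_number (R : realType) (n : nat) : R :=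
  \sum_(1 <= j < n.+1) j%:R^-1.

(* Euler's integral of the second kind. It represents the gamma function for
   0 < x only: for x <= 0 the integral diverges and the value is junk. *)
Definition Gamma (R : realType) (x : R) : R :=
  \int[@lebesgue_measure R]_(t in `]0, +oo[) (t `^ (x - 1) * expR (- t)).

(* Main.v *)
Require Import Defs.
From HB Require Import structures.
From mathcomp Require Import all_boot all_order all_algebra.
From mathcomp Require Import all_classical all_reals all_analysis.
From mathcomp Require Import measurable_realfun.
From mathcomp Require Import ring lra zify.

Import Order.TTheory GRing.Theory Num.Theory.
Import numFieldNormedType.Exports.

Local Open Scope classical_set_scope.
Local Open Scope ring_scope.

(** Write a_k = (3k)! / (27^k k!^3), so that the k-th term of the series is
    (a_k / 2^k) h_k with h_k = 3 H_{3k} - H_k.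

    The logarithm.  The a_k are the coefficients of the hypergeometric function
    Y(z) = F(1/3, 2/3; 1; z), and h_k is the sum of 1 / (j + 1/3) + 1 / (j + 2/3)
    over j < k, that is, the logarithmic derivative at t = 0 of the Pochhammer
    product (1/3 + t)_k (2/3 + t)_k.  Euler's transformation
    F(1/3 + t, 2/3 + t; 1; z) = (1 - z)^(-2t) F(1/3 - t, 2/3 - t; 1; z),
    differentiated at t = 0, says that the series of the a_k h_k z^k is
    - ln (1 - z) Y(z).  Only its coefficientwise form is used
    ([cubic_coef_third_sum]), and it follows from the recurrence of the a_k.  At
    z = 1/2 the Cauchy product gives ln 2 times Y(1/2).

    The value Y(1/2).  Let J_n(c) be the integral of x^n exp(- c x^3) over x > 0;
    then Gamma(1/3) = 3 J_0(1) and a_k k!^2 J_0(1) J_1(1) = J_{3k}(1) J_{3k+1}(1).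
    A product of two moments is a double integral, and the substitution x = y s
    turns it into a single integral of moments with parameter 1 + s^3
    ([cubic_moment_mul]).  Three such products are needed.
    - J_0 J_1 is half the integral of 1 / (3 (s^2 - s + 1)), an arctangent; this is
      the reflection formula at 1/3 ([cubic_moment01]).
    - J_0^2 = J_1 B, where B is the integral of (1 + s^3)^(-2/3)
      ([cubic_moment00]).
    - J_{3k} J_1 gives, after summation over k, Y(1/2) J_0 J_1^2 as J_1 times the
      integral of an algebraic function ([cubic_series_integral]).
    The substitution p = s (2 + s^3)^(1/3), for which 1 + p^3 = (1 + s^3)^2, turns
    this last algebraic integral into a multiple of B ([cubic_duplication]).
    Eliminating B and J_1 leaves Y(1/2) as a multiple of J_0^3.

    All integrands are nonnegative, so every exchange of sums and integrals is
    made with extended real values, and the finiteness of J_0 and J_1 comes out of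
    the first product. *)

(** * Hypergeometric coefficients and harmonic numbers *)

Section Coefficients.
Context {R : realType}.
Implicit Types k m n : nat.

Definition cubic_coef k : R := 'C(2 * k, k)%:R * 'C(3 * k, k)%:R / 27 ^+ k.

Lemma multinomial_fact k :
  ('C(2 * k, k) * 'C(3 * k, k) * k`! ^ 3)%N = ((3 * k)`!)%N.
Proof.
have h2 : ('C(2 * k, k) * (k`! * k`!))%N = ((2 * k)`!)%N.
  have e : (k = 2 * k - k)%N by lia.
  by rewrite {4}e bin_fact//; lia.
have h3 : ('C(3 * k, k) * (k`! * (2 * k)`!))%N = ((3 * k)`!)%N.
  have e : (2 * k = 3 * k - k)%N by lia.
  by rewrite e bin_fact//; lia.
rewrite -h3 -h2; lia.
Qed.

Lemma cubic_coef_fact k :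
  cubic_coef k * (k`!%:R ^+ 3 * 27 ^+ k) = (3 * k)`!%:R.
Proof.
rewrite -multinomial_fact /cubic_coef natrM natrX natrM.
have : (27 : R) ^+ k != 0 by rewrite expf_neq0.
by move=> ?; field.
Qed.

Lemma cubic_coef0 : cubic_coef 0 = 1.
Proof. by rewrite /cubic_coef !muln0 bin0 !mul1r invr1. Qed.

Lemma cubic_coef_ge0 k : 0 <= cubic_coef k.
Proof. by rewrite /cubic_coef divr_ge0 ?mulr_ge0 ?exprn_ge0. Qed.

(** The contiguity relation that makes the [cubic_coef] the coefficients of
    F(1/3, 2/3; 1; z). *)
Lemma cubic_coefS k : cubic_coef k.+1 * k.+1%:R ^+ 2 =
  (k%:R + 3^-1) * (k%:R + 2 / 3) * cubic_coef k.
Proof.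
have := cubic_coef_fact k.+1; have := cubic_coef_fact k.
have -> : (3 * k.+1 = (3 * k).+3)%N by lia.
rewrite !factS !natrM => <-.
rewrite (exprS 27) exprMn.
have n3 i : (3 * k + i)%:R = 3 * k%:R + i%:R :> R by rewrite natrD natrM.
rewrite -[(3 * k).+3]addn3 -[(3 * k).+2]addn2 -[(3 * k).+1]addn1 !n3 -[k.+1%:R]natr1.
set a := cubic_coef _; set b := cubic_coef _; set f := k`!%:R : R.
have f0 : f != 0 by rewrite pnatr_eq0 -lt0n fact_gt0.
have k0 : (k%:R + 1 : R) != 0 by rewrite natr1 pnatr_eq0.
have : (27 : R) ^+ k != 0 by rewrite expf_neq0.
set p := 27 ^+ k => p0 h.
have h3 : (k%:R + 1) * (f ^+ 3 * p) * 27 != 0 by rewrite !mulf_neq0// expf_neq0.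
apply: (mulIf h3).
transitivity (a * ((k%:R + 1) ^+ 3 * f ^+ 3 * (27 * p))).
  by ring.
by rewrite h; field.
Qed.

(** Among the fractions 3 / j with j <= 3k, those with j divisible by 3 add up to
    the k-th harmonic number; subtracting it leaves the residues 1 and 2 modulo 3
    ([third_sumS]). *)
Definition third_sum k : R := 3 * harmonic_number R (3 * k) - harmonic_number R k.

Lemma third_sum0 : third_sum 0 = 0.
Proof. by rewrite /third_sum /harmonic_number muln0 !big_geq// mulr0 subr0. Qed.

Lemma harmonic_numberS k :
  harmonic_number R k.+1 = harmonic_number R k + k.+1%:R^-1.
Proof. by rewrite /harmonic_number big_nat_recr. Qed.

Lemma third_sumS k :
  third_sum k.+1 = third_sum k + (k%:R + 3^-1)^-1 + (k%:R + 2 / 3)^-1.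
Proof.
rewrite /third_sum.
have -> : (3 * k.+1 = (3 * k).+3)%N by lia.
have n3 i : (3 * k + i)%:R = 3 * k%:R + i%:R :> R by rewrite natrD natrM.
rewrite !harmonic_numberS.
rewrite -[(3 * k).+3]addn3 -[(3 * k).+2]addn2 -[(3 * k).+1]addn1 !n3 -[k.+1%:R]natr1.
have k0 := ler0n R k.
by field; do !(apply/andP; split); apply/lt0r_neq0; lra.
Qed.

(** The derivative of Euler's transformation, read on the coefficient of z^k.
    Both sides satisfy
    (k+1)^2 X_{k+1} - (k + 1/3)(k + 2/3) X_k = (2k + 1) a_k.
    For the convolution this comes from
    (k+1)^2 / (k+1-j) = (k + 1 + j) + j^2 / (k+1-j)
    followed by the recurrence of the a_j, which absorbs the factor j^2. *)
Lemma cubic_coef_third_sum k :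
  \sum_(0 <= j < k) cubic_coef j / (k - j)%:R = cubic_coef k * third_sum k.
Proof.
elim: k => [|k IH]; first by rewrite big_geq// third_sum0 mulr0.
have kk : k.+1%:R ^+ 2 != 0 :> R by rewrite expf_neq0// pnatr_eq0.
apply: (mulIf kk).
transitivity ((k%:R + 3^-1) * (k%:R + 2 / 3) * (cubic_coef k * third_sum k)
              + cubic_coef k * (2 * k%:R + 1)); last first.
  rewrite [RHS]mulrAC cubic_coefS third_sumS.
  have := ler0n R k => k0.
  by field; apply/andP; split; apply/lt0r_neq0; lra.
rewrite -IH mulr_suml.
have -> : \sum_(0 <= j < k.+1) cubic_coef j / (k.+1 - j)%:R * k.+1%:R ^+ 2 =
  \sum_(0 <= j < k.+1) (cubic_coef j * (k.+1%:R + j%:R)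
     + cubic_coef j * j%:R ^+ 2 / (k.+1 - j)%:R).
  apply: eq_big_nat => j /andP[_ jk].
  have : (k.+1 - j)%:R != 0 :> R by rewrite pnatr_eq0; lia.
  rewrite natrB -?[k.+1%:R]natr1; last lia.
  by move=> ?; field.
rewrite big_split/=.
rewrite [X in _ + X]big_nat_recl// expr0n mulr0 mul0r add0r.
(* Here the index has been shifted: j now stands for j + 1. *)
rewrite [X in _ + X](_ : _ = \sum_(0 <= j < k)
    ((k%:R + 3^-1) * (k%:R + 2 / 3) * (cubic_coef j / (k - j)%:R)
     - cubic_coef j * (k.+1%:R + j%:R))); last first.
  apply: eq_big_nat => j /andP[_ jk].
  have -> : (k.+1 - j.+1 = k - j)%N by lia.
  have : (k - j)%:R != 0 :> R by rewrite pnatr_eq0; lia.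
  rewrite [cubic_coef j.+1 * _]cubic_coefS natrB; last lia.
  by rewrite -natr1 => ?; field.
rewrite sumrB -mulr_sumr big_nat_recr//= -natr1; ring.
Qed.

End Coefficients.

(** * Series with nonnegative terms *)

Section NonnegativeSeries.
Context {R : realType}.
Implicit Types u v : nat -> R.

Lemma eseries_EFin u (U : R) : series u @ \oo --> U ->
  (\sum_(k <oo) (u k)%:E)%E = U%:E.
Proof.
move=> uU; apply/cvg_lim => //.
apply: cvg_EFin; first by apply: nearW => n; rewrite sumEFin.
by under eq_fun do rewrite /= sumEFin.
Qed.

Lemma cvg_series_eseries u (U : R) : (forall k, 0 <= u k) ->
  (\sum_(k <oo) (u k)%:E)%E = U%:E -> series u @ \oo --> U.
Proof.
move=> u0 uU.
have cu : cvgn (series u) by apply: nnseries_is_cvg => //; rewrite uU ltry.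
have /eseries_EFin : series u @ \oo --> limn (series u) by [].
by rewrite uU => -[->].
Qed.

(** For nonnegative terms the product is a rearrangement: sum the array
    u_j v_(k-j), j <= k, by columns instead of by rows. *)
Lemma cvg_cauchy_product u v (U V : R) : (forall k, 0 <= u k) -> (forall k, 0 <= v k) ->
  series u @ \oo --> U -> series v @ \oo --> V ->
  series (fun k => \sum_(0 <= j < k.+1) u j * v (k - j)%N) @ \oo --> U * V.
Proof.
move=> u0 v0 uU vV; apply: cvg_series_eseries => [k|].
  by apply: sumr_ge0 => j _; rewrite mulr_ge0.
pose a k j : \bar R := if (j <= k)%N then (u j * v (k - j)%N)%:E else 0%E.
have a0 k j : (0 <= a k j)%E.
  by rewrite /a; case: ifP => // _; rewrite lee_fin mulr_ge0.
transitivity (\sum_(k <oo) \sum_(j <oo) a k j)%E.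
  apply: eq_eseriesr => k _.
  rewrite (nneseries_split 0 k.+1)// eseries0 ?adde0.
    rewrite -sumEFin; apply: eq_big_nat => j /andP[_ jk].
    by rewrite /a -ltnS jk.
  by move=> j kj _; rewrite /a leqNgt -ltnS ltnS kj.
rewrite nneseries_interchange//.
transitivity (\sum_(j <oo) (V%:E * (u j)%:E))%E.
  apply: eq_eseriesr => j _.
  rewrite (nneseries_split 0 j)// big_nat big1 ?add0e; last first.
    by move=> k /andP[_ kj]; rewrite /a leqNgt kj.
  rewrite -nneseries_addn//.
  transitivity (\sum_(k <oo) ((u j)%:E * (v k)%:E))%E.
    by apply: eq_eseriesr => k _; rewrite /a leq_addl addnK.
  rewrite nneseriesZl; last by move=> k _; rewrite lee_fin.
  by rewrite (eseries_EFin _ _ vV) muleC.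
rewrite nneseriesZl; last by move=> k _; rewrite lee_fin.
by rewrite (eseries_EFin _ _ uU) -EFinM mulrC.
Qed.

(** The remainder g_n(x) of the expansion of - ln (1 - x) has derivative
    x^n / (1 - x), so the mean value theorem bounds it by 2^-n at x = 1/2. *)
Lemma cvg_series_ln2 :
  series (fun k => k%:R^-1 / 2 ^+ k : R) @ \oo --> ln (2 : R).
Proof.
pose g n (x : R) := - ln (1 - x) - \sum_(0 <= k < n.+1) k%:R^-1 * x ^+ k.
have dg n (x : R) : x < 1 -> is_derive x 1 (g n) (x ^+ n / (1 - x)).
  move=> x1; have x10 : 0 < 1 - x by rewrite subr_gt0.
  elim: n => [|n IH].
    have -> : g 0%N = - (@ln R \o (cst 1 - id)).
      by apply/funext => y; rewrite /g big_nat1 invr0 mul0r subr0.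
    apply: is_derive_eq.
      by apply: is_deriveN; apply: is_derive1_comp; exact: is_derive1_ln.
    by rewrite /= sub0r mulrN1 opprK mul1r.
  have -> : g n.+1 = g n - n.+1%:R^-1 *: (id ^+ n.+1).
    apply/funext => y; rewrite /g big_nat_recr//= opprD addrA.
    by rewrite !fctE.
  apply: is_derive_eq.
  rewrite /= exprS /GRing.scale/= mulr1 mulKf ?pnatr_eq0//.
  have : 1 - x != 0 by rewrite gt_eqF.
  by move=> ?; field.
rewrite -(cvg_shiftS (series _)).
have h2 : (2^-1 : R) < 1 by lra.
have gE n : g n 2^-1 = ln 2 - series (fun k => k%:R^-1 / 2 ^+ k) n.+1.
  rewrite /g; congr (_ - _).
    have -> : 1 - 2^-1 = 2^-1 :> R by lra.
    by rewrite lnV ?opprK// posrE.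
  by apply: eq_bigr => k _; rewrite exprVn.
have g0 n : g n 0 = 0.
  rewrite /g subr0 ln1 oppr0 sub0r big1_seq ?oppr0// => k _.
  by case: k => [|k]; rewrite ?invr0 ?mul0r// expr0n mulr0.
have gb n : 0 <= g n 2^-1 <= 2^-1 ^+ n.
  have cg : {within `[0, 2^-1], continuous (g n)}.
    apply: derivable_within_continuous => x; rewrite in_itv/= => /andP[_ xh].
    by have [] := dg n x (le_lt_trans xh h2).
  have [|x|x + +] := @MVT _ (g n) (fun x => x ^+ n / (1 - x)) 0 2^-1 _ _ cg.
  - by [].
  - by rewrite in_itv/= => /andP[_ xh]; apply: dg; lra.
  rewrite in_itv/= => /andP[x0 xh]; rewrite g0 !subr0 => ->.
  have xn : 0 <= x ^+ n <= 2^-1 ^+ n.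
    by rewrite exprn_ge0 ?(ltW x0)//= lerXn2r ?nnegrE ?(ltW x0) ?(ltW xh).
  have y1 : 0 < 1 - x by lra.
  have i0 : 0 <= (1 - x)^-1 by rewrite invr_ge0 ltW.
  have i2 : (1 - x)^-1 <= 2 by rewrite -[leRHS]invrK lef_pV2 ?posrE//; lra.
  by move: xn i0 i2; move: (x ^+ n) (1 - x)^-1 (_ ^+ n) => a b c /andP[? ?]; nra.
have -> : [sequence series (fun k => k%:R^-1 / 2 ^+ k : R) n.+1]_n
   = fun n => ln 2 - g n 2^-1.
  by apply/funext => n; rewrite gE opprB addrC subrK.
rewrite -[ln 2 in X in _ --> X]subr0; apply: cvgB; first exact: cvg_cst.
apply: (@squeeze_cvgr _ _ _ _ (cst 0) (fun n => 2^-1 ^+ n)).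
- by apply: nearW => n; exact: gb.
- exact: cvg_cst.
- by apply: cvg_expr; rewrite ger0_norm.
Qed.

End NonnegativeSeries.

(** * Integrals over the positive half-line *)

Section HalfLine.
Context {R : realType}.
Implicit Types (f g F G : R -> R) (a b x y : R).
Local Notation mu := (@lebesgue_measure R).

(** Extended real valued, so that it is meaningful for every nonnegative integrand
    before any integrability is known. *)
Definition half_line_integral f := (\int[mu]_(x in `]0%R, +oo[) (f x)%:E)%E.

Lemma measurable_half_line f : (forall x, 0 < x -> {for x, continuous f}) ->
  measurable_fun (`]0, +oo[%classic : set R) f.
Proof.
move=> cf; apply: open_continuous_measurable_fun; first exact: interval_open.
by move=> x; rewrite inE/= in_itv/= andbT; exact: cf.
Qed.

Lemma continuous_within_half_line f a b : 0 < a ->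
  (forall x, 0 < x -> {for x, continuous f}) -> {within `[a, b], continuous f}.
Proof.
move=> a0 cf; apply: continuous_in_subspaceT => x.
by rewrite inE/= in_itv/= => /andP[ax _]; apply: cf; exact: lt_le_trans ax.
Qed.

(** Exhausting the half-line by compact intervals, so that theorems about segments
    apply to integrands that are singular or unbounded at 0 and at infinity. *)
Lemma cvg_half_line_integral f (a b : nat -> R) :
  (forall x, 0 < x -> 0 <= f x) -> (forall x, 0 < x -> {for x, continuous f}) ->
  (forall n, 0 < a n) -> nonincreasing_seq a -> nondecreasing_seq b ->
  a @ \oo --> (0 : R) -> b @ \oo --> +oo ->
  (\int[mu]_(x in `[a n, b n]) (f x)%:E)%E @[n --> \oo] --> half_line_integral f.
Proof.
move=> f0 cf a0 na nb ca cb.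
have sub n : `[a n, b n]%classic `<=` `]0, +oo[%classic.
  by move=> x /=; rewrite !in_itv/= andbT => /andP[ax _]; exact: lt_le_trans ax.
have -> : half_line_integral f =
    (\int[mu]_(x in \bigcup_n `[a n, b n]%classic) (f x)%:E)%E.
  congr (integral _ _ _); apply/seteqP; split=> [x|x [n _]]; last exact: sub.
  rewrite /= in_itv/= andbT => x0.
  have : \forall n \near \oo, x <= b n by move/cvgryPge : cb; exact.
  have : \forall n \near \oo, a n <= x.
    move/cvgrPdist_le : ca => /(_ x x0); apply: filterS => n.
    by rewrite sub0r normrN ger0_norm// ltW.
  move=> Ha Hb; near \oo => n; exists n => //=.
  by rewrite in_itv/=; apply/andP; split; near: n.
apply: ge0_nondecreasing_set_cvg_integral => //.
- move=> m n mn; rewrite subsetEset => x /=; rewrite !in_itv/= => /andP[ax xb].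
  by rewrite (le_trans _ ax) ?na//= (le_trans xb)// nb.
- move=> n; apply/measurable_EFinP.
  exact: measurable_funS (sub n) (measurable_half_line _ cf).
- move=> n x /sub; rewrite /= in_itv/= andbT lee_fin; exact: f0.
Unshelve. all: by end_near. Qed.

Let lo n : R := n.+1%:R^-1.
Let hi n : R := n.+1%:R.

Let lo_gt0 n : 0 < lo n. Proof. by rewrite invr_gt0. Qed.

Let lo_noninc : nonincreasing_seq lo.
Proof. by move=> m n mn; rewrite lef_pV2 ?posrE// ler_nat. Qed.

Let hi_nondec : nondecreasing_seq hi.
Proof. by move=> m n mn; rewrite ler_nat. Qed.

Let lo_le_hi n : lo n <= hi n.
Proof. by rewrite (@le_trans _ _ 1)// ?invf_le1 ?ler1n. Qed.

Let cvg_lo : lo @ \oo --> (0 : R). Proof. exact: cvg_harmonic. Qed.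

Let cvg_hi : hi @ \oo --> +oo.
Proof. by rewrite (cvg_shiftS (fun n => n%:R : R)); exact: cvgr_idn. Qed.

Let cvg_comp_lo F (l : R) : F x @[x --> 0^'+] --> l -> F (lo n) @[n --> \oo] --> l.
Proof. by move/cvg_at_rightP; apply; split. Qed.

(** The derivative of F may blow up at both ends, as it does for x^3 at infinity. *)
Lemma half_line_substitution F f G :
  (forall x, 0 < x -> is_derive x 1 F (f x)) ->
  (forall x, 0 < x -> 0 < f x) -> (forall x, 0 < x -> 0 < F x) ->
  (forall x, 0 < x -> {for x, continuous f}) ->
  F x @[x --> 0^'+] --> (0 : R) -> F x @[x --> +oo] --> +oo ->
  (forall x, 0 < x -> 0 <= G x) -> (forall x, 0 < x -> {for x, continuous G}) ->
  half_line_integral G = half_line_integral (fun x => G (F x) * f x).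
Proof.
move=> dF f0 F0 cf Fl Fh G0 cG.
have cF x : 0 < x -> {for x, continuous F}.
  by move=> /dF[dFx _]; apply/differentiable_continuous/derivable1_diffP.
have incF x y : 0 < x -> x < y -> F x < F y.
  move=> x0 xy; have dFx z : z \in `]x, y[ -> is_derive z 1 F (f z).
    by rewrite in_itv/= => /andP[xz _]; apply: dF; exact: lt_trans xz.
  have [|z] := MVT xy dFx; first exact: continuous_within_half_line.
  rewrite in_itv/= => /andP[xz _] FE.
  by rewrite -subr_gt0 FE mulr_gt0 ?subr_gt0// f0// (lt_trans x0).
have F'f x : 0 < x -> derive1 F x = f x.
  by move=> /dF[_ <-]; rewrite derive1E.
have cF' x : 0 < x -> {for x, continuous (derive1 F)}.
  move=> x0; rewrite /prop_for /continuous_at F'f//.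
  apply: cvg_trans (cf _ x0); apply: near_eq_cvg.
  by near=> y; apply/esym/F'f; near: y; exact: lt_nbhsr.
have leF x y : 0 < x -> x <= y -> F x <= F y.
  move=> x0; rewrite le_eqVlt => /predU1P[->//|xy].
  exact/ltW/incF.
have h1 : (\int[mu]_(x in `[F (lo n), F (hi n)]) (G x)%:E)%E @[n --> \oo]
    --> half_line_integral G.
  apply: cvg_half_line_integral => //.
  - by move=> n; exact: F0.
  - by move=> m n mn; apply: leF => //; exact: lo_noninc.
  - by move=> m n mn; apply: leF => //; exact: hi_nondec.
  - exact: cvg_comp_lo.
  - exact: cvg_comp Fh.
have h2 : (\int[mu]_(x in `[lo n, hi n]) (G (F x) * f x)%:E)%E @[n --> \oo]
    --> half_line_integral (fun x => G (F x) * f x).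
  apply: cvg_half_line_integral => // x x0.
    by rewrite mulr_ge0 ?(ltW (f0 _ _))// G0 ?F0.
  apply: continuousM; last exact: cf.
  by apply: continuous_comp; [exact: cF|exact/cG/F0].
have h12 n : (\int[mu]_(x in `[F (lo n), F (hi n)]) (G x)%:E)%E =
    (\int[mu]_(x in `[lo n, hi n]) (G (F x) * f x)%:E)%E.
  rewrite integration_by_substitution_increasing//.
  - apply: eq_integral => x; rewrite inE/= in_itv/= => /andP[ax _].
    by rewrite fctE F'f// (lt_le_trans _ ax).
  - move=> x y; rewrite !in_itv/= => /andP[ax _] /andP[ay _] xy.
    by apply: incF => //; exact: lt_le_trans ax.
  - move=> x; rewrite in_itv/= => /andP[ax _].
    by apply: cF'; exact: lt_trans ax.
  - apply/cvg_ex; exists (derive1 F (lo n)).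
    by apply: cvg_at_right_filter; exact: cF'.
  - apply/cvg_ex; exists (derive1 F (hi n)).
    by apply: cvg_at_left_filter; exact: cF'.
  - split.
    + move=> x; rewrite in_itv/= => /andP[ax _].
      by have [] := dF _ (lt_trans (lo_gt0 n) ax).
    + by apply: cvg_at_right_filter; exact: cF.
    + by apply: cvg_at_left_filter; exact: cF.
  - by apply: continuous_within_half_line => //; exact: F0.
rewrite -(cvg_lim _ h1)// -(cvg_lim _ h2)//.
by congr (limn _); apply/funext => n; exact: h12.
Unshelve. all: by end_near. Qed.

(** A form of the fundamental theorem that doubles as integration by parts: the
    two parts of F' = f - g are integrated separately, both possibly infinite. *)
Lemma half_line_FTC_diff F f g (l L : R) :
  (forall x, 0 < x -> is_derive x 1 F (f x - g x)) ->
  (forall x, 0 < x -> 0 <= f x) -> (forall x, 0 < x -> {for x, continuous f}) ->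
  (forall x, 0 < x -> 0 <= g x) -> (forall x, 0 < x -> {for x, continuous g}) ->
  F x @[x --> 0^'+] --> l -> F x @[x --> +oo] --> L ->
  half_line_integral f = (half_line_integral g + (L - l)%:E)%E.
Proof.
move=> dF f0 cf g0 cg Fl FL.
have cF x : 0 < x -> {for x, continuous F}.
  by move=> /dF[dFx _]; apply/differentiable_continuous/derivable1_diffP.
have h1 : (\int[mu]_(x in `[lo n, hi n]) (f x)%:E)%E @[n --> \oo]
    --> half_line_integral f by exact: cvg_half_line_integral.
have h2 : (\int[mu]_(x in `[lo n, hi n]) (g x)%:E)%E @[n --> \oo]
    --> half_line_integral g by exact: cvg_half_line_integral.
have h3 : (F (hi n) - F (lo n))%:E @[n --> \oo] --> (L - l)%:E.
  apply: cvg_EFin; first by apply: nearW.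
  by apply: cvgB; [exact: cvg_comp FL|exact: cvg_comp_lo].
have h23 : ((\int[mu]_(x in `[lo n, hi n]) (g x)%:E) + (F (hi n) - F (lo n))%:E)%E
    @[n --> \oo] --> (half_line_integral g + (L - l)%:E)%E.
  by apply: cvgeD => //; exact: fin_num_adde_defl.
rewrite -(cvg_lim _ h1)// -(cvg_lim _ h23)//.
congr (limn _); apply/funext => n.
have := lo_le_hi n; rewrite le_eqVlt => /predU1P[->|lohi].
  by rewrite set_itv1 !integral_set1 subrr adde0.
have int h : (forall x, 0 < x -> {for x, continuous h}) ->
    mu.-integrable `[lo n, hi n] (EFin \o h).
  move=> ch; apply: continuous_compact_integrable; first exact: segment_compact.
  exact: continuous_within_half_line.
rewrite EFinB -(continuous_FTC2 (f := fun x => f x - g x) (F := F))//.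
- under [X in (_ + X)%E]eq_integral do rewrite EFinB.
  rewrite integralB//; [|exact: int..].
  by rewrite addeC subeK// integrable_fin_num//; exact: int.
- apply: continuous_within_half_line => // x x0.
  by apply: continuousB; [exact: cf|exact: cg].
- split.
  + move=> x; rewrite in_itv/= => /andP[ax _].
    by have [] := dF _ (lt_trans (lo_gt0 n) ax).
  + by apply: cvg_at_right_filter; exact: cF.
  + by apply: cvg_at_left_filter; exact: cF.
- move=> x; rewrite in_itv/= => /andP[ax _]; rewrite derive1E.
  by have [_] := dF _ (lt_trans (lo_gt0 n) ax).
Qed.

Lemma half_line_FTC F f (l L : R) :
  (forall x, 0 < x -> is_derive x 1 F (f x)) ->
  (forall x, 0 < x -> 0 <= f x) -> (forall x, 0 < x -> {for x, continuous f}) ->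
  F x @[x --> 0^'+] --> l -> F x @[x --> +oo] --> L ->
  half_line_integral f = (L - l)%:E.
Proof.
move=> dF f0 cf Fl FL.
have dF' x : 0 < x -> is_derive x 1 F (f x - cst 0 x).
  by move=> x0; rewrite subr0; exact: dF.
have c0 x : 0 < x -> {for x, continuous (cst 0 : R -> R)}.
  by move=> _; exact: cvg_cst.
rewrite (half_line_FTC_diff F f (cst 0) l L dF' f0 cf _ c0 Fl FL)//.
by rewrite {1}/half_line_integral integral0 add0e.
Qed.

Lemma eq_half_line_integral f g : (forall x, 0 < x -> f x = g x) ->
  half_line_integral f = half_line_integral g.
Proof.
move=> fg; apply: eq_integral => x.
by rewrite inE/= in_itv/= andbT => /fg ->.
Qed.

Lemma half_line_integral_ge0 f : (forall x, 0 < x -> 0 <= f x) ->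
  (0 <= half_line_integral f)%E.
Proof.
move=> f0; apply: integral_ge0 => x; rewrite /= in_itv/= andbT lee_fin.
exact: f0.
Qed.

Lemma half_line_integralZ_ereal f (k : \bar R) : (0 <= k)%E ->
  (forall x, 0 < x -> 0 <= f x) -> (forall x, 0 < x -> {for x, continuous f}) ->
  (\int[mu]_(x in `]0%R, +oo[) (k * (f x)%:E) = k * half_line_integral f)%E.
Proof.
move=> k0 f0 cf; apply: ge0_integralZl => //.
- by apply/measurable_EFinP; exact: measurable_half_line.
- by move=> x; rewrite /= in_itv/= andbT lee_fin; exact: f0.
Qed.

Lemma half_line_integralZ f (k : R) : 0 <= k ->
  (forall x, 0 < x -> 0 <= f x) -> (forall x, 0 < x -> {for x, continuous f}) ->
  half_line_integral (fun x => k * f x) = (k%:E * half_line_integral f)%E.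
Proof. by move=> k0 f0 cf; rewrite -half_line_integralZ_ereal. Qed.

End HalfLine.

(** * Moments of exp(- c x^3) *)

Section CubicMoments.
Context {R : realType}.
Implicit Types (c x r : R) (n m k : nat).

Definition cubic_exp c x : R := expR (- (c * x ^+ 3)).

Definition cubic_moment n c : \bar R :=
  half_line_integral (fun x => x ^+ n * cubic_exp c x).

Lemma continuous_cubic_exp c : continuous (cubic_exp c).
Proof.
move=> x; apply: (@continuous_comp _ _ _ (fun x => - (c * x ^+ 3)) expR).
  by apply: cvgN; apply: cvgMl_tmp; exact: exprn_continuous.
exact: continuous_expR.
Qed.

Lemma continuous_cubic_moment n c : continuous (fun x => x ^+ n * cubic_exp c x).
Proof.
by move=> x; apply: cvgM; [exact: exprn_continuous|exact: continuous_cubic_exp].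
Qed.

Lemma cubic_moment_fun_ge0 n c x : 0 < x -> 0 <= x ^+ n * cubic_exp c x.
Proof. by move=> x0; rewrite mulr_ge0 ?expR_ge0// exprn_ge0// ltW. Qed.

Lemma cubic_moment_ge0 n c : (0 <= cubic_moment n c)%E.
Proof. by apply: half_line_integral_ge0 => x; exact: cubic_moment_fun_ge0. Qed.

#[local] Instance is_derive_cubic_exp c x :
  is_derive x 1 (cubic_exp c) (- (3 * c * x ^+ 2) * cubic_exp c x).
Proof.
have -> : cubic_exp c = expR \o (- (c *: (id ^+ 3))).
  by apply/funext => y; rewrite !fctE.
apply: is_derive_eq.
rewrite /= !fctE /GRing.scale/= mulr1; ring.
Qed.

(** Exponential beats power: exp(c x^3) >= exp(c x) >= (c x)^(n+1) / (n+1)! when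
    x >= 1. *)
Lemma cvg_cubic_exp n c : 0 < c -> x ^+ n * cubic_exp c x @[x --> +oo] --> (0 : R).
Proof.
move=> c0.
pose K := n.+1`!%:R / c ^+ n.+1.
apply: (@squeeze_cvgr _ _ _ _ (cst 0) (fun x => K * x^-1)).
- near=> x.
  have x1 : 1 <= x by near: x; exact: nbhs_pinfty_ge.
  have x0 : 0 < x by exact: lt_le_trans x1.
  rewrite cubic_moment_fun_ge0//=.
  rewrite /cubic_exp expRN ler_pdivrMr ?expR_gt0//.
  have : (c * x) ^+ n.+1 / n.+1`!%:R <= expR (c * x ^+ 3).
    apply: (@le_trans _ _ (expR (c * x))); last first.
      rewrite ler_expR ler_pM2l// -[leLHS]expr1.
      by rewrite ler_eXn2l//.
    have := expR_ge1Dxn n (ltW (mulr_gt0 c0 x0)).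
    by apply: le_trans; rewrite lerDr.
  move=> h; apply: le_trans (ler_wpM2l _ h); last first.
    by rewrite mulr_ge0 ?invr_ge0 ?ltW// divr_gt0 ?exprn_gt0// ltr0n fact_gt0.
  rewrite /K exprMn [x ^+ n.+1]exprS.
  have f0 : n.+1`!%:R != 0 :> R by rewrite pnatr_eq0 -lt0n fact_gt0.
  have cn : c ^+ n.+1 != 0 by rewrite expf_neq0// gt_eqF.
  move: f0 cn; move: n.+1`!%:R (c ^+ n.+1) => f d f0 d0.
  rewrite le_eqVlt; apply/orP; left; apply/eqP; field.
  by rewrite d0 f0 gt_eqF.
- exact: cvg_cst.
- rewrite -(mulr0 K); apply: cvgMl_tmp.
  by apply: (gtr0_cvgV0 _).2; [exact: nbhs_pinfty_gt|exact: cvg_id].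
Unshelve. all: by end_near. Qed.

Lemma cvg_right0 (f : R -> R) : {for 0, continuous f} -> f x @[x --> 0^'+] --> f 0.
Proof. by move=> cf; exact: cvg_at_right_filter. Qed.

Lemma cubic_moment2 c : 0 < c -> cubic_moment 2 c = ((3 * c)^-1)%:E.
Proof.
move=> c0.
pose F x := - (3 * c)^-1 * cubic_exp c x.
rewrite /cubic_moment -[(3 * c)^-1]opprK -[- - _]add0r.
apply: (half_line_FTC F).
- move=> x x0; have -> : F = (- (3 * c)^-1) *: cubic_exp c by [].
  apply: is_derive_eq.
  rewrite /GRing.scale/=; field.
  by rewrite gt_eqF.
- by move=> x; exact: cubic_moment_fun_ge0.
- by move=> x _; exact: continuous_cubic_moment.
- have -> : - (3 * c)^-1 = F 0.
    by rewrite /F /cubic_exp expr0n mulr0 oppr0 expR0 mulr1.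
  by apply: cvg_right0; apply: cvgMl_tmp; exact: continuous_cubic_exp.
- rewrite -(mulr0 (- (3 * c)^-1)); apply: cvgMl_tmp.
  by have := cvg_cubic_exp 0 _ c0; under eq_fun do rewrite expr0 mul1r.
Qed.

(** Integration by parts with the primitive x^(n+1) exp(- c x^3), which vanishes at
    both ends. *)
Lemma cubic_momentS n c : 0 < c ->
  cubic_moment (n + 3) c = (((n%:R + 1) / (3 * c))%:E * cubic_moment n c)%E.
Proof.
move=> c0; pose F x := - (3 * c)^-1 * (x ^+ n.+1 * cubic_exp c x).
rewrite /cubic_moment.
have k0 : 0 <= (n%:R + 1) / (3 * c) :> R by rewrite divr_ge0// mulr_ge0// ltW.
rewrite -half_line_integralZ//; last 2 first.
- by move=> x; exact: cubic_moment_fun_ge0.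
- by move=> x _; exact: continuous_cubic_moment.
rewrite -[RHS]adde0 -[X in (_ + X%:E)%E](subrr 0).
apply: (half_line_FTC_diff F).
- move=> x x0; have -> : F = (- (3 * c)^-1) *: ((id ^+ n.+1) * cubic_exp c).
    by apply/funext => y; rewrite /F !fctE.
  apply: is_derive_eq.
  rewrite /= !fctE /GRing.scale/= -natr1 addn3 !exprS; field.
  by rewrite gt_eqF.
- by move=> x; exact: cubic_moment_fun_ge0.
- by move=> x _; exact: continuous_cubic_moment.
- by move=> x x0; rewrite mulr_ge0// cubic_moment_fun_ge0.
- by move=> x _; apply: cvgMl_tmp; exact: continuous_cubic_moment.
- have {2}<- : F 0 = 0 by rewrite /F expr0n mul0r mulr0.
  by apply: cvg_right0; apply: cvgMl_tmp; exact: continuous_cubic_moment.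
- by rewrite -(mulr0 (- (3 * c)^-1)); apply: cvgMl_tmp; exact: cvg_cubic_exp.
Qed.

Lemma cubic_moment_fact k c : 0 < c ->
  cubic_moment (3 * k + 2) c = (k`!%:R / (3 * c ^+ k.+1))%:E.
Proof.
move=> c0; elim: k => [|k IH].
  by rewrite muln0 add0n cubic_moment2// fact0 expr1 div1r.
have -> : (3 * k.+1 + 2 = (3 * k + 2) + 3)%N by lia.
rewrite cubic_momentS// IH -EFinM factS !natrD !natrM -natr1 [c ^+ k.+2]exprS.
congr EFin; field.
by rewrite !gt_eqF// exprn_gt0.
Qed.

Lemma half_line_integral_scale (f : R -> R) r : 0 < r ->
  (forall x, 0 < x -> 0 <= f x) -> (forall x, 0 < x -> {for x, continuous f}) ->
  half_line_integral f = half_line_integral (fun x => f (r * x) * r).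
Proof.
move=> r0 f0 cf; apply: (half_line_substitution ( *%R r) (cst r)) => //.
- move=> x _; have -> : *%R r = r *: (id : R -> R) by [].
  by apply: is_derive_eq; rewrite /GRing.scale/= mulr1.
- by move=> x x0; exact: mulr_gt0.
- by move=> x _; exact: cvg_cst.
- rewrite -[X in _ --> X](mulr0 r); apply: cvg_right0.
  by apply: cvgMl_tmp; exact: cvg_id.
- by apply: gt0_cvgMry => //; exact: cvg_id.
Qed.

(** Substitute r x for x. *)
Lemma cubic_moment_scale n r : 0 < r ->
  cubic_moment n 1 = ((r ^+ n.+1)%:E * cubic_moment n (r ^+ 3))%E.
Proof.
move=> r0; rewrite /cubic_moment.
rewrite (half_line_integral_scale _ _ r0).
- rewrite -half_line_integralZ//.
  + apply: eq_half_line_integral => x _.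
    by rewrite /cubic_exp mul1r !exprMn [r ^+ n.+1]exprS; ring.
  + by rewrite exprn_ge0// ltW.
  + by move=> x; exact: cubic_moment_fun_ge0.
  + by move=> x _; exact: continuous_cubic_moment.
- by move=> x; exact: cubic_moment_fun_ge0.
- by move=> x _; exact: continuous_cubic_moment.
Qed.

End CubicMoments.

(** * Products of moments *)

Section MomentProducts.
Context {R : realType}.
Implicit Types (c x y s r : R) (n m k : nat).
Local Notation mu := (@lebesgue_measure R).
Local Notation D := (`]0%R, +oo[%classic : set R).

(** Tonelli on the quadrant, reduced to the plane by multiplying the integrand by
    indicator functions. *)
Lemma half_line_tonelli (h : R -> R -> R) :
  measurable_fun setT (fun z : R * R => h z.1 z.2) ->
  (forall y s, 0 < y -> 0 < s -> 0 <= h y s) ->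
  (\int[mu]_(y in D) half_line_integral (h y) =
   \int[mu]_(s in D) half_line_integral (h^~ s))%E.
Proof.
move=> mh h0.
have inD x : (x \in D) = (0 < x) by rewrite mem_setE in_itv/= andbT.
pose f (z : R * R) : \bar R := (h z.1 z.2 * \1_D z.1 * \1_D z.2)%:E.
have mf : measurable_fun setT f.
  apply/measurable_EFinP; apply: measurable_funM; first apply: measurable_funM => //.
    by apply: measurableT_comp => //; exact: measurable_indic.
  by apply: measurableT_comp => //; exact: measurable_indic.
have f0 z : (0 <= f z)%E.
  rewrite lee_fin /f !indicE !inD.
  have [z1|_] := boolP (0 < z.1); last by rewrite mulr0 mul0r.
  have [z2|_] := boolP (0 < z.2); last by rewrite mulr0.
  by rewrite !mulr1 h0.
have := @fubini_tonelli _ _ _ _ _ mu mu f mf f0.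
congr (_ = _).
  rewrite [RHS]integral_mkcond; apply: eq_integral => y _; rewrite patchE inD.
  case: ifPn => y0; last first.
    by apply: integral0_eq => s _; rewrite /f/= indicE inD (negbTE y0) mulr0 mul0r.
  rewrite /half_line_integral [RHS]integral_mkcond; apply: eq_integral => s _.
  rewrite patchE inD /f/= !indicE !inD y0.
  by case: ifPn => s0; rewrite ?mulr1 ?mulr0.
rewrite [RHS]integral_mkcond; apply: eq_integral => s _; rewrite patchE inD.
case: ifPn => s0; last first.
  by apply: integral0_eq => y _; rewrite /f/= [X in _ * X]indicE inD (negbTE s0) mulr0.
rewrite /half_line_integral [RHS]integral_mkcond; apply: eq_integral => y _.
rewrite patchE inD /f/= !indicE !inD s0.
by case: ifPn => y0; rewrite ?mulr1 ?mulr0 ?mul0r.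
Qed.

(** The analogue for exp(- x^3) of the Beta-Gamma identity: in the double integral
    of x^n y^m exp(- x^3 - y^3), put x = y s and integrate over y first. *)
Lemma cubic_moment_mul n m : (cubic_moment n 1 * cubic_moment m 1 =
  \int[mu]_(s in D) ((s ^+ n)%:E * cubic_moment (n + m).+1 (1 + s ^+ 3)))%E.
Proof.
pose h y s := y ^+ (n + m).+1 * s ^+ n * cubic_exp (1 + s ^+ 3) y.
have ce := @continuous_cubic_moment R.
transitivity (\int[mu]_(y in D) half_line_integral (h y))%E.
  rewrite -half_line_integralZ_ereal; last 3 first.
  - exact: cubic_moment_ge0.
  - by move=> x; exact: cubic_moment_fun_ge0.
  - by move=> x _; exact: ce.
  apply: eq_integral => y; rewrite inE/= in_itv/= andbT => y0.
  rewrite (cubic_moment_scale n _ y0) muleAC -EFinM -half_line_integralZ.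
  - apply: eq_half_line_integral => s _.
    rewrite /h /cubic_exp.
    have -> : - ((1 + s ^+ 3) * y ^+ 3) = - (1 * y ^+ 3) + - (y ^+ 3 * s ^+ 3).
      by ring.
    by rewrite expRD [y ^+ (n + m).+1]exprS exprD [y ^+ n.+1]exprS; ring.
  - by rewrite mulr_ge0 ?cubic_moment_fun_ge0// exprn_ge0// ltW.
  - by move=> x; exact: cubic_moment_fun_ge0.
  - by move=> x _; exact: ce.
rewrite half_line_tonelli.
- apply: eq_integral => s; rewrite inE/= in_itv/= andbT => s0.
  rewrite -half_line_integralZ.
  + by apply: eq_half_line_integral => y _; rewrite /h mulrCA mulrA.
  + by rewrite exprn_ge0// ltW.
  + by move=> x; exact: cubic_moment_fun_ge0.
  + by move=> x _; exact: ce.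
- rewrite /h /cubic_exp; apply: measurable_funM => /=.
    by apply: measurable_funM; apply: measurable_funX.
  apply: measurableT_comp => //; apply: measurable_funN.
  apply: measurable_funM; last exact: measurable_funX.
  by apply: measurable_funD => //; apply: measurable_funX.
- by move=> y s y0 s0; rewrite /h !mulr_ge0 ?expR_ge0 ?exprn_ge0 ?ltW.
Qed.

End MomentProducts.

(** * The cube root and an arctangent integral *)

Section CubeRoot.
Context {R : realType}.
Implicit Types x y : R.

Definition cbrt x : R := x `^ 3^-1.

Lemma cbrt_gt0 x : 0 < x -> 0 < cbrt x.
Proof. exact: powR_gt0. Qed.

Lemma cbrtK x : 0 <= x -> cbrt x ^+ 3 = x.
Proof.
move=> x0; rewrite -powR_mulrn ?powR_ge0// -powRrM mulVf ?powRr1//.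
Qed.

Lemma cbrt_expr3 x : 0 <= x -> cbrt (x ^+ 3) = x.
Proof.
by move=> x0; rewrite /cbrt -powR_mulrn// -powRrM mulfV ?powRr1.
Qed.

Lemma cbrtM x y : 0 <= x -> 0 <= y -> cbrt (x * y) = cbrt x * cbrt y.
Proof. exact: powRM. Qed.

Lemma is_derive_cbrt x : 0 < x -> is_derive x 1 cbrt (3 * cbrt x ^+ 2)^-1.
Proof.
move=> x0; have := is_derive1_powR 3^-1 x0.
rewrite powRB ?powRr1 ?ltW//; last by rewrite (gt_eqF x0) implybT.
rewrite -/(cbrt x) -{1}[X in _ / X](cbrtK x) ?ltW//.
have c0 : cbrt x != 0 by rewrite gt_eqF// cbrt_gt0.
have -> // : 3^-1 * (cbrt x / cbrt x ^+ 3) = (3 * cbrt x ^+ 2)^-1.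
by field.
Qed.

Lemma continuous_cbrt x : 0 < x -> {for x, continuous cbrt}.
Proof.
by move=> /is_derive_cbrt[? _]; apply/differentiable_continuous/derivable1_diffP.
Qed.

Lemma continuous_cbrt_cube (a x : R) : 0 < a -> 0 < x ->
  {for x, continuous (fun y => cbrt (a + y ^+ 3))}.
Proof.
move=> a0 x0; apply: continuous_comp.
  by apply: cvgD; [exact: cvg_cst|exact: exprn_continuous].
by apply: continuous_cbrt; rewrite addr_gt0// exprn_gt0.
Qed.

End CubeRoot.

Section ArctanValue.
Context {R : realType}.

(** The triple angle at pi / 6: expanding cos (3 x) = 0 gives
    4 sin^2 x = 1 when cos x is nonzero. *)
Lemma atan_sqrt3V : atan (Num.sqrt 3)^-1 = pi / 6 :> R.
Proof.
have p0 := @pi_gt0 R.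
have h : (pi / 6 : R) \in `](- (pi / 2)), (pi / 2)[.
  by rewrite in_itv/=; lra.
have c0 : 0 < cos (pi / 6 : R) by apply: cos_gt0_pihalf; lra.
have s0 : 0 < sin (pi / 6 : R) by apply: sin_gt0_pi; lra.
have c3 : cos (pi / 6 + (pi / 6 + pi / 6) : R) = 0.
  by rewrite (_ : _ + _ = pi / 2) ?cos_pihalf//; field.
move: c3; rewrite !cosD sinD => c3.
have e := cos2Dsin2 (pi / 6 : R).
rewrite -[RHS]tanK//; congr (atan _); rewrite /tan.
move: c0 s0 c3 e; move: (cos _) (sin _) => c s c0 s0 c3 e.
have sE : s = 2^-1.
  have : c * ((2 * s - 1) * (2 * s + 1)) = 0.
    by nra.
  move=> /eqP; rewrite !mulf_eq0 gt_eqF//= => /orP[|] /eqP; lra.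
have cE : c = Num.sqrt 3 / 2.
  have : c ^+ 2 = (Num.sqrt 3 / 2) ^+ 2.
    by rewrite exprMn sqr_sqrtr//; move: e; rewrite sE => e; lra.
  by move/eqP; rewrite eqrXn2 ?ltW ?divr_ge0 ?sqrtr_ge0// => /eqP.
rewrite sE cE.
have : Num.sqrt 3 != 0 :> R by rewrite gt_eqF// sqrtr_gt0.
by move=> ?; field.
Qed.

(** A primitive is 2 / (3 sqrt 3) atan ((2 s - 1) / sqrt 3), whose
    arctangent runs from - pi / 6 to pi / 2. *)
Lemma half_line_integral_quadratic :
  half_line_integral (fun s : R => (3 * (s ^+ 2 - s + 1))^-1) =
  (4 * pi / (9 * Num.sqrt 3))%:E.
Proof.
pose r : R := Num.sqrt 3.
have r0 : 0 < r by rewrite sqrtr_gt0.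
have r2 : r ^+ 2 = 3 by rewrite sqr_sqrtr.
have q0 (s : R) : 0 < s ^+ 2 - s + 1.
  by have := sqr_ge0 (s - 2^-1); rewrite sqrrB; nra.
pose A : R -> R := fun s => (2 * s - 1) / r.
pose F : R -> R := fun s => 2 / (3 * r) * atan (A s).
have -> : 4 * pi / (9 * r) = 2 / (3 * r) * (pi / 2) - 2 / (3 * r) * (- (pi / 6)).
  by field; rewrite gt_eqF.
apply: (half_line_FTC F).
- move=> s s0; have -> : F = (2 / (3 * r)) *: (@atan R \o (r^-1 *: (2 *: id - cst 1))).
    by apply/funext => y; rewrite /F /A !fctE /GRing.scale/= [_ / r]mulrC.
  apply: is_derive_eq.
  rewrite /= !fctE /GRing.scale/=.
  rewrite subr0 !mulr1 exprMn exprVn r2.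
  have -> : 3^-1 * (2 * s - 1) ^+ 2 = (4 * (s ^+ 2 - s + 1) - 3) / 3 by field.
  have rE : 2 / (3 * r) * r^-1 = 2 / 9.
    by rewrite -mulrA -invfM -mulrA -expr2 r2; field.
  rewrite mulrA [_ * (r^-1 * 2)]mulrA [X in X * 2]mulrAC rE.
  have := q0 s; move: (s ^+ 2 - s + 1) => q q1.
  by field; rewrite !gt_eqF//; lra.
- by move=> s _; rewrite invr_ge0 mulr_ge0// ltW.
- move=> s _; apply: cvgV; first by rewrite gt_eqF// mulr_gt0.
  apply: cvgMl_tmp; apply: cvgD; last exact: cvg_cst.
  by apply: cvgB; [exact: exprn_continuous|exact: cvg_id].
- apply: cvgMl_tmp.
  have <- : atan (A 0) = - (pi / 6).
    by rewrite /A mulr0 sub0r mulN1r atanN atan_sqrt3V.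
  apply: (@cvg_right0 R (fun x => atan (A x))).
  apply: continuous_comp; last exact: continuous_atan.
  apply: cvgMr_tmp; apply: cvgB; last exact: cvg_cst.
  by apply: cvgMl_tmp; exact: cvg_id.
- apply: cvgMl_tmp; apply: (cvg_comp A _ _ (@cvgy_atan R)).
  apply: (@ger_cvgy _ _ _ _ (fun s => r^-1 * s)).
    near=> s; rewrite /A mulrC ler_pM2r ?invr_gt0//.
    have : 1 <= s by near: s; exact: nbhs_pinfty_ge.
    by lra.
  by apply: gt0_cvgMry; rewrite ?invr_gt0//; exact: cvg_id.
Unshelve. all: by end_near. Qed.

End ArctanValue.

(** * Relations between the moments of order 0 and 1 *)

Section MomentValues.
Context {R : realType}.
Implicit Types (c x s w : R) (n k : nat).
Local Notation mu := (@lebesgue_measure R).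
Local Notation D := (`]0%R, +oo[%classic : set R).
Local Notation J := (@cubic_moment R).

(** The product can be computed in two ways, as the integral of 1 / (3 (1 + s^3))
    or, exchanging the factors, of s / (3 (1 + s^3)).  In the sum of the two the
    factor 1 + s cancels, so no logarithm appears in the primitive. *)
Lemma cubic_moment01 : (J 0 1 * J 1 1 = (2 * pi / (9 * Num.sqrt 3))%:E)%E.
Proof.
have c1 s : 0 < s -> 0 < 1 + s ^+ 3.
  by move=> s0; rewrite addr_gt0// exprn_gt0.
pose f s : R := (3 * (1 + s ^+ 3))^-1.
have f0 s : 0 < s -> 0 <= f s.
  by move=> s0; rewrite invr_ge0 mulr_ge0// ltW// c1.
have cf s : 0 < s -> {for s, continuous f}.
  move=> s0; apply: cvgV; first by rewrite gt_eqF// mulr_gt0// c1.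
  by apply: cvgMl_tmp; apply: cvgD; [exact: cvg_cst|exact: exprn_continuous].
have h01 : (J 0 1 * J 1 1)%E = half_line_integral f.
  rewrite cubic_moment_mul; apply: eq_integral => s.
  rewrite inE/= in_itv/= andbT => s0.
  by rewrite expr0 mul1e cubic_moment2// c1.
have h10 : (J 0 1 * J 1 1)%E = half_line_integral (fun s => s * f s).
  rewrite muleC cubic_moment_mul; apply: eq_integral => s.
  rewrite inE/= in_itv/= andbT => s0.
  by rewrite expr1 cubic_moment2// c1.
have h : (J 0 1 * J 1 1 + J 0 1 * J 1 1)%E = (4 * pi / (9 * Num.sqrt 3))%:E.
  rewrite {1}h01 h10 -half_line_integral_quadratic -ge0_integralD//.
  - apply: eq_integral => s; rewrite inE/= in_itv/= andbT => s0.
    rewrite -EFinD; congr EFin; rewrite /f.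
    have q0 : 0 < s ^+ 2 - s + 1.
      by have := sqr_ge0 (s - 2^-1); rewrite sqrrB; nra.
    have -> : 1 + s ^+ 3 = (1 + s) * (s ^+ 2 - s + 1) by ring.
    by field; rewrite !gt_eqF//; lra.
  - by move=> s; rewrite /= in_itv/= andbT lee_fin; exact: f0.
  - by apply/measurable_EFinP; exact: measurable_half_line.
  - move=> s; rewrite /= in_itv/= andbT lee_fin => s0.
    by rewrite mulr_ge0 ?f0// ltW.
  - apply/measurable_EFinP; apply: measurable_half_line => s s0.
    by apply: cvgM; [exact: cvg_id|exact: cf].
have J0 : (0 <= J 0 1 * J 1 1)%E by rewrite mule_ge0 ?cubic_moment_ge0.
move: h J0; case: (J 0 1 * J 1 1)%E => //= r [h] _; congr EFin.
have : r + r = 2 * (2 * pi / (9 * Num.sqrt 3)) by rewrite h; ring.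
lra.
Qed.

(** The product of J_0(1) and J_1(1) is positive and finite, which forces both
    factors to be so. *)
Lemma cubic_moment01_fin : exists a b : R,
  [/\ 0 < a, 0 < b, J 0 1 = a%:E, J 1 1 = b%:E &
      a * b = 2 * pi / (9 * Num.sqrt 3)].
Proof.
have K0 : 0 < 2 * pi / (9 * Num.sqrt 3) :> R.
  by rewrite divr_gt0 ?mulr_gt0 ?pi_gt0 ?sqrtr_gt0.
have := cubic_moment01; have := cubic_moment_ge0 1 (1 : R).
have := cubic_moment_ge0 0 (1 : R).
move: K0; move: (2 * pi / _) => K K0.
case: (J 0 1) (J 1 1) => [a||] [b||]//; rewrite ?lee_fin => a0 b0.
- move=> [abK]; exists a, b.
  have : a * b != 0 by rewrite abK gt_eqF.
  rewrite mulf_eq0 negb_or => /andP[a1 b1].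
  by split => //; rewrite lt_neqAle eq_sym ?a1 ?b1.
- move: a0; rewrite le_eqVlt => /predU1P[<-|a0].
    by rewrite mul0e => -[K00]; rewrite -K00 ltxx in K0.
  by rewrite gt0_muley ?lte_fin.
- move: b0; rewrite le_eqVlt => /predU1P[<-|b0].
    by rewrite mule0 => -[K00]; rewrite -K00 ltxx in K0.
  by rewrite gt0_mulye ?lte_fin.
Qed.

Lemma cubic_moment_3k k : (J (3 * k) 1 * J (3 * k + 1) 1 =
  (cubic_coef k * k`!%:R ^+ 2)%:E * (J 0 1 * J 1 1))%E.
Proof.
elim: k => [|k IH].
  by rewrite muln0 cubic_coef0 fact0 expr1n mulr1 mul1e.
have -> : (3 * k.+1 = 3 * k + 3)%N by lia.
have -> : (3 * k + 3 + 1 = 3 * k + 1 + 3)%N by lia.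
rewrite !cubic_momentS// muleACA IH muleA -!EFinM.
congr (_%:E * _)%E.
rewrite factS (natrM _ k.+1) exprMn [in RHS]mulrA cubic_coefS.
by rewrite natrD natrM; field.
Qed.

Lemma cubic_moment1E c : 0 < c -> J 1 c = ((cbrt c ^+ 2)^-1%:E * J 1 1)%E.
Proof.
move=> c0; rewrite (cubic_moment_scale 1 (cbrt c)) ?cbrt_gt0//.
rewrite cbrtK ?ltW// muleA -EFinM mulVf ?mul1e//.
by rewrite expf_neq0// gt_eqF// cbrt_gt0.
Qed.

Lemma cubic_moment00 : (J 0 1 * J 0 1 =
  J 1 1 * half_line_integral (fun s : R => (cbrt (1 + s ^+ 3) ^+ 2)^-1)%R)%E.
Proof.
have c1 s : 0 < s -> 0 < 1 + s ^+ 3.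
  by move=> s0; rewrite addr_gt0// exprn_gt0.
rewrite cubic_moment_mul -half_line_integralZ_ereal.
- apply: eq_integral => s; rewrite inE/= in_itv/= andbT => s0.
  by rewrite expr0 mul1e [LHS]cubic_moment1E ?c1// muleC.
- exact: cubic_moment_ge0.
- by move=> s _; rewrite invr_ge0 sqr_ge0.
- move=> s s0; apply: cvgV; first by rewrite expf_neq0// gt_eqF// cbrt_gt0// c1.
  by have cc := continuous_cbrt_cube 1 s ltr01 s0; exact: (cvgM cc cc).
Qed.

Lemma eseries_exp x : (\sum_(k <oo) (x ^+ k / k`!%:R)%:E)%E = (expR x)%:E.
Proof.
by apply: eseries_EFin; rewrite /expR; exact: is_cvg_series_exp_coeff.
Qed.

(** Expanding exp(w x^3) under the integral shifts the parameter c by w. *)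
Lemma cubic_moment_gen n c w : 0 <= w ->
  (\sum_(k <oo) ((w ^+ k / k`!%:R)%:E * J (3 * k + n) c) = J n (c - w))%E.
Proof.
move=> w0.
have wk k : 0 <= w ^+ k / k`!%:R by rewrite divr_ge0// exprn_ge0.
transitivity (\sum_(k <oo) \int[mu]_(x in D)
  (w ^+ k / k`!%:R * (x ^+ (3 * k + n) * cubic_exp c x))%:E)%E.
  apply: eq_eseriesr => k _; rewrite -half_line_integralZ//.
  - by move=> x; exact: cubic_moment_fun_ge0.
  - by move=> x _; exact: continuous_cubic_moment.
rewrite -integral_nneseries//; last 2 first.
- move=> k; apply/measurable_EFinP; apply: measurable_half_line => x _.
  by apply: cvgMl_tmp; exact: continuous_cubic_moment.
- move=> k x; rewrite /= in_itv/= andbT lee_fin => x0.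
  by rewrite mulr_ge0// cubic_moment_fun_ge0.
apply: eq_integral => x; rewrite inE/= in_itv/= andbT => x0.
transitivity (\sum_(k <oo) ((x ^+ n * cubic_exp c x)%:E *
    ((w * x ^+ 3) ^+ k / k`!%:R)%:E))%E.
  apply: eq_eseriesr => k _; rewrite -EFinM; congr EFin.
  by rewrite exprD exprM [in RHS]exprMn; ring.
rewrite nneseriesZl; last first.
  by move=> k _; rewrite lee_fin divr_ge0// exprn_ge0// mulr_ge0// exprn_ge0// ltW.
rewrite eseries_exp -EFinM -mulrA; congr (_ * _)%:E.
rewrite /cubic_exp -expRD; congr expR; ring.
Qed.

End MomentValues.

(** * The hypergeometric series as an integral *)

Section SeriesValue.
Context {R : realType}.
Implicit Types (x s : R) (k : nat).
Local Notation mu := (@lebesgue_measure R).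
Local Notation D := (`]0%R, +oo[%classic : set R).
Local Notation J := (@cubic_moment R).

(* With these, J_{3k}(1) J_1(1) = k! 2^k int g(s) w(s)^k ds, and w(s) < 1. *)
Let g s : R := (3 * (1 + s ^+ 3))^-1.
Let w s : R := s ^+ 3 / (2 * (1 + s ^+ 3)).

Let cube_gt0 s : 0 < s -> 0 < 1 + s ^+ 3.
Proof. by move=> s0; rewrite addr_gt0// exprn_gt0. Qed.

Let g_ge0 s : 0 < s -> 0 <= g s.
Proof. by move=> s0; rewrite invr_ge0 mulr_ge0// ltW// cube_gt0. Qed.

Let w_ge0 s : 0 < s -> 0 <= w s.
Proof.
by move=> s0; rewrite divr_ge0 ?mulr_ge0 ?exprn_ge0 ?ltW// cube_gt0.
Qed.

Let continuous_cube s : {for s, continuous (fun s : R => 1 + s ^+ 3)}.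
Proof. by apply: cvgD; [exact: cvg_cst|exact: exprn_continuous]. Qed.

Let continuous_g s : 0 < s -> {for s, continuous g}.
Proof.
move=> s0; apply: cvgV; first by rewrite gt_eqF// mulr_gt0// cube_gt0.
by apply: cvgMl_tmp; exact: continuous_cube.
Qed.

Let continuous_w s : 0 < s -> {for s, continuous w}.
Proof.
move=> s0; apply: cvgM; first exact: exprn_continuous.
apply: cvgV; first by rewrite gt_eqF// mulr_gt0// cube_gt0.
by apply: cvgMl_tmp; exact: continuous_cube.
Qed.

Let continuous_gw k s : 0 < s ->
  {for s, continuous (fun s => g s * (w s ^+ k / k`!%:R))}.
Proof.
move=> s0; apply: cvgM; first exact: continuous_g.
apply: cvgMr_tmp; apply: (@continuous_comp _ _ _ w (fun y => y ^+ k)).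
  exact: continuous_w.
exact: exprn_continuous.
Qed.

Let gw_ge0 k s : 0 < s -> 0 <= g s * (w s ^+ k / k`!%:R).
Proof. by move=> s0; rewrite mulr_ge0 ?g_ge0// divr_ge0// exprn_ge0// w_ge0. Qed.

(** The product J_{3k} J_{3k+1} on the left is a_k k!^2 J_0 J_1; the factor J_1
    that multiplies it is paired with J_{3k}, which becomes an integral over s. *)
Lemma cubic_coef_moment k :
  ((cubic_coef k / 2 ^+ k)%:E * (J 0 1 * J 1 1 * J 1 1) =
   \int[mu]_(s in D) ((g s)%:E * ((w s ^+ k / k`!%:R)%:E * J (3 * k + 1) 1)))%E.
Proof.
have k0 : (k`!%:R : R) != 0 by rewrite pnatr_eq0 -lt0n fact_gt0.
transitivity (half_line_integral (fun s => g s * (w s ^+ k / k`!%:R))%R *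
    J (3 * k + 1) 1)%E.
  transitivity ((k`!%:R ^+ 2 * 2 ^+ k)^-1%:E * (J (3 * k) 1 * J 1 1) *
      J (3 * k + 1) 1)%E.
    rewrite -[RHS]muleA (muleAC (J (3 * k) 1)) cubic_moment_3k !muleA -EFinM.
    congr (_%:E * _ * _ * _)%E.
    by field; rewrite k0/= expf_neq0.
  congr (_ * _)%E; rewrite cubic_moment_mul.
  have -> : ((3 * k + 1).+1 = 3 * k + 2)%N by lia.
  pose f s : R := s ^+ (3 * k) * (k`!%:R / (3 * (1 + s ^+ 3) ^+ k.+1)).
  transitivity ((k`!%:R ^+ 2 * 2 ^+ k)^-1%:E * half_line_integral f)%E.
    congr (_ * _)%E; apply: eq_integral => s.
    rewrite inE/= in_itv/= andbT => s0.
    by rewrite cubic_moment_fact ?cube_gt0.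
  rewrite -half_line_integralZ.
  - apply: eq_half_line_integral => s s0; rewrite /f /g /w exprM.
    have := cube_gt0 _ s0; move: (s ^+ 3) => u u0.
    rewrite exprMn exprVn exprMn [(1 + u) ^+ k.+1]exprS.
    by field; rewrite k0/= !expf_neq0//= gt_eqF.
  - by rewrite invr_ge0 mulr_ge0// exprn_ge0.
  - move=> s s0; rewrite /f mulr_ge0// ?divr_ge0// ?mulr_ge0 ?exprn_ge0// ltW//.
    exact: cube_gt0.
  - move=> s s0; apply: cvgM; first exact: exprn_continuous.
    apply: cvgMl_tmp; apply: cvgV.
      by rewrite mulf_neq0// expf_neq0// gt_eqF// cube_gt0.
    apply: cvgMl_tmp.
    apply: (@continuous_comp _ _ _ (fun s : R => 1 + s ^+ 3) (fun y => y ^+ k.+1)).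
      exact: continuous_cube.
    exact: exprn_continuous.
rewrite muleC -half_line_integralZ_ereal.
- by apply: eq_integral => s _; rewrite EFinM muleC muleA.
- exact: cubic_moment_ge0.
- by move=> s; exact: gw_ge0.
- by move=> s; exact: continuous_gw.
Qed.

Let w1E s : 0 < s -> 1 - w s = (2 + s ^+ 3) / (2 * (1 + s ^+ 3)).
Proof.
move=> /cube_gt0; rewrite /w; move: (s ^+ 3) => t t0.
by field; rewrite gt_eqF.
Qed.

Let w1_gt0 s : 0 < s -> 0 < 1 - w s.
Proof.
move=> s0; rewrite w1E// divr_gt0 ?mulr_gt0 ?cube_gt0//.
by rewrite addr_gt0// exprn_gt0.
Qed.

(** Summing over k under the integral sign, [cubic_moment_gen] replaces the moments
    J_{3k+1}(1) by J_1(1 - w(s)), a multiple of J_1(1). *)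
Lemma cubic_series_integral :
  (\sum_(k <oo) ((cubic_coef k / 2 ^+ k)%:E * (J 0 1 * J 1 1 * J 1 1)) =
   J 1 1 * half_line_integral (fun s => g s * (cbrt (1 - w s) ^+ 2)^-1)%R)%E.
Proof.
under eq_eseriesr do rewrite cubic_coef_moment.
rewrite -integral_nneseries//; last 2 first.
- move=> k; rewrite (_ : (fun s => _) = (fun s =>
      J (3 * k + 1) 1 * (g s * (w s ^+ k / k`!%:R))%:E)%E); last first.
    by apply/funext => s; rewrite EFinM muleA muleC.
  apply: measurable_funeM; apply/measurable_EFinP.
  by apply: measurable_half_line => s; exact: continuous_gw.
- move=> k s; rewrite /= in_itv/= andbT => s0.
  rewrite !mule_ge0 ?cubic_moment_ge0// lee_fin ?g_ge0//.
  by rewrite divr_ge0// exprn_ge0// w_ge0.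
rewrite -half_line_integralZ_ereal.
- apply: eq_integral => s; rewrite inE/= in_itv/= andbT => s0.
  rewrite nneseriesZl; last first.
    move=> k _; rewrite mule_ge0 ?cubic_moment_ge0// lee_fin.
    by rewrite divr_ge0// exprn_ge0// w_ge0.
  rewrite cubic_moment_gen ?w_ge0// cubic_moment1E ?w1_gt0//.
  by rewrite muleA -EFinM muleC.
- exact: cubic_moment_ge0.
- by move=> s s0; rewrite mulr_ge0 ?g_ge0// invr_ge0 sqr_ge0.
- move=> s s0; apply: cvgM; first exact: continuous_g.
  apply: cvgV; first by rewrite expf_neq0// gt_eqF// cbrt_gt0// w1_gt0.
  have cc : {for s, continuous (fun s => cbrt (1 - w s))}.
    apply: (@continuous_comp _ _ _ (fun s => 1 - w s) cbrt).
      by apply: cvgB; [exact: cvg_cst|exact: continuous_w].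
    by apply: continuous_cbrt; exact: w1_gt0.
  exact: (cvgM cc cc).
Qed.

(** The substitution p = s (2 + s^3)^(1/3) satisfies 1 + p^3 = (1 + s^3)^2 and
    dp = 2 (1 + s^3) (2 + s^3)^(-2/3) ds, so the powers of 1 + s^3 combine to the
    exponent - 1/3 that the left-hand side has. *)
Lemma cubic_duplication :
  half_line_integral (fun s => g s * (cbrt (1 - w s) ^+ 2)^-1) =
  ((cbrt 2 ^+ 2 / 6)%:E *
   half_line_integral (fun s : R => (cbrt (1 + s ^+ 3) ^+ 2)^-1)%R)%E.
Proof.
pose F s : R := s * cbrt (2 + s ^+ 3).
pose f s : R := 2 * (1 + s ^+ 3) / cbrt (2 + s ^+ 3) ^+ 2.
have t0 s : 0 < s -> 0 < 2 + s ^+ 3.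
  by move=> s0; rewrite addr_gt0// exprn_gt0.
have F3 s : 0 < s -> 1 + F s ^+ 3 = (1 + s ^+ 3) ^+ 2.
  by move=> s0; rewrite /F exprMn cbrtK ?ltW ?t0//; ring.
have ccont a s : 0 < a -> 0 < s ->
    {for s, continuous (fun s => cbrt (a + s ^+ 3) ^+ 2)}.
  move=> a0 s0; have cc := continuous_cbrt_cube a s a0 s0.
  exact: (cvgM cc cc).
pose G s : R := (cbrt (1 + s ^+ 3) ^+ 2)^-1.
have G0 s : 0 < s -> 0 <= G s by move=> _; rewrite invr_ge0 sqr_ge0.
have cG s : 0 < s -> {for s, continuous G}.
  move=> s0; apply: cvgV; first by rewrite expf_neq0// gt_eqF// cbrt_gt0// cube_gt0.
  exact: ccont.
have F0 s : 0 < s -> 0 < F s.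
  by move=> s0; rewrite mulr_gt0// cbrt_gt0// t0.
have f0 s : 0 < s -> 0 < f s.
  by move=> s0; rewrite divr_gt0 ?exprn_gt0 ?mulr_gt0 ?cbrt_gt0 ?t0 ?cube_gt0.
have cf s : 0 < s -> {for s, continuous f}.
  move=> s0; apply: cvgM.
    by apply: cvgMl_tmp; exact: continuous_cube.
  apply: cvgV; first by rewrite expf_neq0// gt_eqF// cbrt_gt0// t0.
  exact: ccont.
have dF s : 0 < s -> is_derive s 1 F (f s).
  move=> s0; have dc := is_derive_cbrt _ (t0 _ s0).
  have -> : F = id * (@cbrt R \o (cst 2 + (id ^+ 3))).
    by apply/funext => y; rewrite /F !fctE.
  apply: is_derive_eq.
  rewrite /= !fctE /GRing.scale/= /f.
  have := cbrtK _ (ltW (t0 _ s0)); have := cbrt_gt0 _ (t0 _ s0).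
  move: (cbrt _) => c c0 c3.
  have -> : 2 * (1 + s ^+ 3) = c ^+ 3 + s ^+ 3 by rewrite c3; ring.
  by field; rewrite gt_eqF.
rewrite (half_line_substitution F f G)//.
- rewrite -half_line_integralZ.
  + apply: eq_half_line_integral => s s0.
    rewrite /G /f /g F3// w1E//.
    have t1 := cube_gt0 _ s0; have t2 := t0 _ s0.
    have A0 := cbrt_gt0 _ t1; have B0 := cbrt_gt0 _ t2.
    have C0 : 0 < cbrt (2 : R) by rewrite cbrt_gt0.
    have rE : cbrt ((2 + s ^+ 3) / (2 * (1 + s ^+ 3))) =
        cbrt (2 + s ^+ 3) / (cbrt 2 * cbrt (1 + s ^+ 3)).
      apply: (canRL (mulfK _)); first by rewrite gt_eqF// mulr_gt0.
      have t3 : 0 < 2 * (1 + s ^+ 3) by rewrite mulr_gt0.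
      rewrite -(cbrtM 2) ?(ltW t1)// -cbrtM ?divr_ge0 ?(ltW t2) ?(ltW t3)//.
      by rewrite divfK// gt_eqF.
    rewrite rE (expr2 (1 + s ^+ 3)) cbrtM ?ltW//.
    move: A0 B0 C0 (cbrtK _ (ltW t1)).
    move: (cbrt (1 + _)) (cbrt (2 + _)) (cbrt 2) => A B C A0 B0 C0 <-.
    by field; rewrite !gt_eqF.
  + by rewrite divr_ge0// sqr_ge0.
  + by move=> s s0; rewrite mulr_ge0 ?invr_ge0 ?sqr_ge0// ltW// f0.
  + move=> s s0; apply: cvgM; last exact: cf.
    apply: (@continuous_comp _ _ _ F G); last exact/cG/F0.
    by have [dFs _] := dF _ s0; apply/differentiable_continuous/derivable1_diffP.
- have F00 : F 0 = 0 by rewrite /F mul0r.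
  have := cvg_right0 F; rewrite F00; apply.
  apply: cvgM; first exact: cvg_id.
  apply: (@continuous_comp _ _ _ (fun s : R => 2 + s ^+ 3) cbrt).
    by apply: cvgD; [exact: cvg_cst|exact: exprn_continuous].
  by apply: continuous_cbrt; rewrite expr0n addr0.
- apply: (@ger_cvgy _ _ _ _ id); last exact: cvg_id.
  near=> s; have s0 : 0 < s by near: s; exact: nbhs_pinfty_gt.
  rewrite /F ler_peMr ?(ltW s0)// -[leLHS](powRr0 (2 + s ^+ 3)).
  apply: ler_powR; last by rewrite invr_ge0.
  by have := exprn_gt0 3 s0; lra.
Unshelve. all: by end_near. Qed.

Lemma cubic_series_moments :
  (\sum_(k <oo) ((cubic_coef k / 2 ^+ k)%:E * (J 0 1 * J 1 1 * J 1 1)) =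
   (cbrt 2 ^+ 2 / 6)%:E * (J 0 1 * J 0 1))%E.
Proof.
by rewrite cubic_series_integral cubic_duplication muleCA -cubic_moment00.
Qed.

End SeriesValue.

(** * The value in terms of Gamma(1/3) *)

Section GammaValue.
Context {R : realType}.
Implicit Types (x s : R) (k : nat).
Local Notation J := (@cubic_moment R).

(** Dividing [cubic_series_moments] by J_0 J_1^2. *)
Lemma cubic_series (a b : R) : 0 < a -> 0 < b -> J 0 1 = a%:E -> J 1 1 = b%:E ->
  series (fun k => cubic_coef k / 2 ^+ k) @ \oo -->
    (cbrt 2 ^+ 2 * a / (6 * b ^+ 2) : R).
Proof.
move=> a0 b0 Ja Jb; apply: cvg_series_eseries => [k|].
  by rewrite divr_ge0 ?cubic_coef_ge0// exprn_ge0.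
have := @cubic_series_moments R; rewrite Ja Jb.
under eq_eseriesr do rewrite muleC.
rewrite -!EFinM nneseriesZl; last first.
  by move=> k _; rewrite lee_fin divr_ge0 ?cubic_coef_ge0// exprn_ge0.
have c0 : 0 < a * b * b by rewrite !mulr_gt0.
case: (\sum_(k <oo) _)%E => [r||]; last 2 first.
- by rewrite gt0_muley ?lte_fin.
- by rewrite gt0_muleNy ?lte_fin.
rewrite -EFinM => -[h]; congr EFin; apply: (mulfI (lt0r_neq0 c0)).
by rewrite h; field; rewrite !gt_eqF.
Qed.

(** Substitute t = x^3 in Euler's integral. *)
Lemma Gamma_third (a : R) : J 0 1 = a%:E -> Gamma (3^-1 : R) = 3 * a.
Proof.
move=> Ja; pose G (t : R) := t `^ (3^-1 - 1) * expR (- t).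
rewrite /Gamma /Rintegral -/(half_line_integral G).
have cG t : 0 < t -> {for t, continuous G}.
  move=> t0; apply: cvgM.
    have cp : {for t, continuous (@powR R ^~ (3^-1 - 1))}.
      have [? _] := is_derive1_powR (3^-1 - 1) t0.
      exact/differentiable_continuous/derivable1_diffP.
    exact: cp.
  by apply: (@continuous_comp _ _ _ -%R expR); [exact: cvgN|exact: continuous_expR].
have -> : half_line_integral G =
    half_line_integral (fun x => G (x ^+ 3) * (3 * x ^+ 2)).
  apply: (half_line_substitution (fun x => x ^+ 3)) => //.
  - move=> x x0; have -> : (fun x : R => x ^+ 3) = id ^+ 3.
      by apply/funext => y; rewrite !fctE.
    by apply: is_derive_eq; rewrite /GRing.scale/= mulr1.
  - by move=> x x0; rewrite mulr_gt0// exprn_gt0.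
  - by move=> x x0; rewrite exprn_gt0.
  - by move=> x x0; apply: cvgMl_tmp; exact: exprn_continuous.
  - have := @cvg_right0 R (fun x => x ^+ 3); rewrite expr0n; apply.
    exact: exprn_continuous.
  - apply: (@ger_cvgy _ _ _ _ id); last exact: cvg_id.
    near=> x; have x1 : 1 <= x by near: x; exact: nbhs_pinfty_ge.
    by rewrite -[leLHS]expr1 ler_weXn2l.
  - by move=> t t0; rewrite mulr_ge0 ?powR_ge0 ?expR_ge0.
have -> : half_line_integral (fun x => G (x ^+ 3) * (3 * x ^+ 2)) =
    half_line_integral (fun x => 3 * (x ^+ 0 * cubic_exp 1 x)).
  apply: eq_half_line_integral => x x0.
  rewrite /G /cubic_exp mul1r powRB; last first.
    by rewrite expf_neq0 ?implybT// gt_eqF.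
  rewrite -/(cbrt _) cbrt_expr3 ?powRr1 ?exprn_ge0 ?(ltW x0)//.
  by field; rewrite gt_eqF.
rewrite half_line_integralZ//.
- by rewrite -/(J 0 1) Ja.
- by move=> x; exact: cubic_moment_fun_ge0.
- by move=> x _; exact: continuous_cubic_moment.
Unshelve. all: by end_near. Qed.

End GammaValue.

Lemma cubic_series_Gamma (R : realType) :
  series (fun k => cubic_coef k / 2 ^+ k) @ \oo -->
    (3 * Gamma (3^-1 : R) ^+ 3 / (4 * pi ^+ 2 * 2 `^ 3^-1) : R).
Proof.
have [a [b [a0 b0 Ja Jb ab]]] := @cubic_moment01_fin R.
rewrite (Gamma_third _ Ja) -/(cbrt 2).
have -> : 3 * (3 * a) ^+ 3 / (4 * pi ^+ 2 * cbrt 2) =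
    cbrt 2 ^+ 2 * a / (6 * b ^+ 2); last exact: cubic_series.
have p0 := @pi_gt0 R; have r0 : 0 < Num.sqrt 3 :> R by rewrite sqrtr_gt0.
have c0 : 0 < cbrt (2 : R) by rewrite cbrt_gt0.
(* (a b)^2 = (2 pi / (9 sqrt 3))^2 eliminates b. *)
have ab2 : (a * b) ^+ 2 = 4 * pi ^+ 2 / 243.
  by rewrite ab expr_div_n !exprMn sqr_sqrtr//; field.
apply: (@mulIf _ (cbrt 2 * (a * b) ^+ 2)).
  by rewrite gt_eqF// mulr_gt0// exprn_gt0// mulr_gt0.
transitivity (cbrt 2 ^+ 3 * a ^+ 3 / 6); last by field; rewrite gt_eqF.
rewrite ab2 cbrtK//; move: (@pi R) p0 {ab ab2} => p p0.
by field; rewrite !gt_eqF.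
Qed.

Theorem theorem1p1 (R : realType) :
  series (fun k : nat =>
      ('C(2 * k, k)%:R * 'C(3 * k, k)%:R) / 54 ^+ k
      * (3 * harmonic_number R (3 * k) - harmonic_number R k) : R) @ \oo
    --> (3 * ln 2) * Gamma (3^-1 : R) ^+ 3 / (4 * pi ^+ 2 * 2 `^ 3^-1).
Proof.
have -> : (3 * ln 2) * Gamma (3^-1 : R) ^+ 3 / (4 * pi ^+ 2 * 2 `^ 3^-1) =
    3 * Gamma (3^-1 : R) ^+ 3 / (4 * pi ^+ 2 * 2 `^ 3^-1) * ln 2 by ring.
have := cvg_cauchy_product _ _ _ _ _ _ (cubic_series_Gamma R) (@cvg_series_ln2 R).
set u := (fun k => \sum_(0 <= j < k.+1) _) => cu.
rewrite (_ : (fun k : nat => _) = u).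
  apply: cu => k; rewrite divr_ge0 ?cubic_coef_ge0// ?invr_ge0// exprn_ge0//.
apply/funext => k; rewrite -/(third_sum k) /u.
(* The term j = k vanishes because the inverse of 0 is 0. *)
rewrite big_nat_recr//= subnn invr0 mul0r mulr0 addr0.
transitivity (cubic_coef k * @third_sum R k / 2 ^+ k).
  by rewrite /cubic_coef (_ : 54 = 27 * 2) ?exprMn -?natrM// invfM; ring.
rewrite -cubic_coef_third_sum mulr_suml; apply: eq_big_nat => j /andP[_ jk].
have -> : 2 ^+ k = 2 ^+ j * 2 ^+ (k - j) :> R by rewrite -exprD subnKC// ltnW.
by rewrite invfM; ring.
Qed.
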